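(* For every $r>0$ there exists a Banach space $X$ such that $$\mathcal T^{cc}(X)=\mathcal T(X)=\mathcal T^s(X)=\frac{r}{1+r}.$$
   Context: All Banach spaces are nontrivial and real. $B_X$ and $S_X$ denote the closed unit ball and the unit sphere of $X$, $X^*$ is the dual, and $B(x,\rho)$ is the ball with center $x$ and radius $\rho$. A slice of $B_X$ is a set $S(B_X,x^*,\alpha)=\{x\in B_X: x^*(x)>1-\alpha\}$ with $x^*\in S_{X^*}$ and $\alpha>0$. A convex combination of subsets $W_1,\dots,W_n$ of $B_X$ is a set $\sum_{i=1}^n\lambda_iW_i=\{\sum_i\lambda_iw_i: w_i\in W_i\}$ with $n\in\mathbb N$, $\lambda_i\in[0,1]$, $\sum_{i=1}^n\lambda_i=1$. The Daugavet indices of thickness are: - $\mathcal T^s(X)=\inf\{\rho>0:$ there exist $x\in S_X$ and a slice $S$ of $B_X$ such that $S\subset B(x,\rho)\}$; - $\mathcal T(X)=\inf\{\rho>0:$ there exist $x\in S_X$ and a relatively weakly open subset $W$ of $B_X$ such that $\emptyset\ne W\subset B(x,\rho)\}$; - $\mathcal T^{cc}(X)=\inf\{\rho>0:$ there exist $x\in S_X$ and a convex combination $C$ of relatively weakly open subsets of $B_X$ such that $\emptyset\ne C\subset B(x,\rho)\}$. *)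

(* Defs.v *)
From mathcomp Require Import all_boot all_order all_algebra.
From mathcomp Require Import all_classical all_reals all_analysis.

Set Implicit Arguments.
Unset Strict Implicit.
Unset Printing Implicit Defensive.

Import Order.TTheory GRing.Theory Num.Theory.
Import numFieldNormedType.Exports.

Local Open Scope classical_set_scope.
Local Open Scope ring_scope.

Section DaugavetIndices.
Variables (R : realType) (X : completeNormedModType R).

Definition unit_ball : set X := [set x | `|x| <= 1].
Definition unit_sphere : set X := [set x | `|x| = 1].

Definition dual : Type := {f : {scalar X} | continuous (f : X -> R)}.

Definition dual_fun (f : dual) : X -> R := sval f.
Coercion dual_fun : dual >-> Funclass.

(* The set is nonempty and, by continuity of f, bounded, so the real supremum
   is not a default value. *)
Definition dual_norm (f : dual) : R := sup [set `|f x| | x in unit_ball].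

Definition dual_sphere : set dual := [set f | dual_norm f = 1].

(* sigma(X, X* ): the coarsest topology on X that makes every element of the
   dual continuous. *)
Definition weak_space : topologicalType :=
  sup_topology (fun f : dual => Topological.on (initial_topology (f : X -> R))).

Definition weakly_open (U : set X) : Prop := @open weak_space U.

Definition rel_weakly_open (W : set X) : Prop :=
  exists2 U, weakly_open U & W = unit_ball `&` U.

Definition slice (f : dual) (a : R) : set X :=
  [set x | unit_ball x /\ 1 - a < f x].

Definition is_slice (S : set X) : Prop :=
  exists f a, [/\ dual_sphere f, 0 < a & S = slice f a].

Definition convex_combination (n : nat) (l : 'I_n -> R) (W : 'I_n -> set X) :
    set X :=
  [set \sum_(i < n) l i *: w i | w in [set w | forall i, W i (w i)]].

(* n = 0 is excluded by the condition that the coefficients sum to 1. *)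
Definition is_cc_weakly_open (C : set X) : Prop :=
  exists (n : nat) (l : 'I_n -> R) (W : 'I_n -> set X),
    [/\ forall i, 0 <= l i <= 1, \sum_(i < n) l i = 1,
        forall i, rel_weakly_open (W i) & C = convex_combination l W].

(* Each infimum is that of a set of reals bounded below by 0, nonempty when X is
   nontrivial. Here ball x rho is the open ball; closed balls give the same
   infima. *)
Definition daugavet_Ts : R :=
  inf [set rho | 0 < rho /\ exists x S,
    [/\ unit_sphere x, is_slice S & S `<=` ball x rho]].

Definition daugavet_T : R :=
  inf [set rho | 0 < rho /\ exists x W,
    [/\ unit_sphere x, rel_weakly_open W, W !=set0 & W `<=` ball x rho]].

Definition daugavet_Tcc : R :=
  inf [set rho | 0 < rho /\ exists x C,
    [/\ unit_sphere x, is_cc_weakly_open C, C !=set0 & C `<=` ball x rho]].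

End DaugavetIndices.

(* Main.v *)
Require Import Defs.
From HB Require Import structures.
From mathcomp Require Import all_boot all_order all_algebra.
From mathcomp Require Import all_classical all_reals all_analysis.
From mathcomp Require Import ring lra.

(** The space is [R x l_oo] with norm [max(|a|, (|a| + |y|_oo) / (1 + r))]: its
    unit ball is a double cone of height and radius [1 + r], truncated at height
    [1], where the radius is [r]. The slices [a > 1 - e] shrink to the top face,
    which has radius [r / (1 + r)] around its centre [(1, 0)]. Conversely the
    points of a convex combination of relatively weakly open sets can all be
    perturbed along a weakly null unit vector of [l_oo] so that one coordinate
    becomes [r] or [-r], with the sign opposite to that of the given [x]; the
    resulting point is at distance at least [r / (1 + r)] from [x]. *)

Import Order.TTheory GRing.Theory Num.Theory.
Import numFieldNormedType.Exports.

Local Open Scope classical_set_scope.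
Local Open Scope ring_scope.

(** * Weak neighbourhoods, slices, and reduction of the three indices to two estimates *)

Section WeakTopology.
Context {R : realType} {X : completeNormedModType R}.

(** Convergence in a supremum of topologies may be tested in each of them, here in the initial
    topology of each functional. *)
Lemma weakly_open_near (U : set X) (x : X) (v : nat -> X) :
    weakly_open U -> U x -> (forall f : dual X, f \o v @ \oo --> f x) ->
  \forall n \near \oo, U (v n).
Proof.
move=> oU Ux vx.
have Uw : nbhs (x : weak_space X) (U : set (weak_space X)).
  by apply: open_nbhs_nbhs; split.
suff: v @ \oo --> (x : weak_space X) by apply.
apply/cvg_sup => f A /=.
rewrite (@nbhsE (initial_topology (f : X -> R))) => -[_ [[B oB <-] Bx] BA].
apply: filterS BA _.
exact: (vx f B (open_nbhs_nbhs (conj oB Bx))).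
Qed.

Lemma slice_rel_weakly_open (f : dual X) (a : R) : rel_weakly_open (slice f a).
Proof.
exists [set x | 1 - a < f x]; last by [].
have /continuousP cf x : @continuous_at (weak_space X) R x f.
  move=> A Afx; have /= := @initial_continuous X R (f : X -> R) x _ Afx.
  by have /cvg_sup/(_ f) := @cvg_id _ (nbhs (x : weak_space X)); apply.
exact: (cf [set y | 1 - a < y] (@open_gt R (1 - a))).
Qed.

(** The norm of [f] is a supremum of [|f x|]; since the ball is symmetric, a near-maximiser can be
    negated to make [f x] positive. *)
Lemma slice_neq0 (f : dual X) (a : R) :
  dual_sphere f -> 0 < a -> slice f a !=set0.
Proof.
move=> f1 a0; set E := [set `|f x| | x in @unit_ball R X].
(* Without a genuine supremum [sup E] would take its default value [0], not [1]. *)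
have sE : has_sup E.
  apply: contrapT => /sup_out E0; move: f1.
  rewrite /dual_sphere /dual_norm/= -/E E0.
  by move/eqP; rewrite eq_sym oner_eq0.
have [_ [x x1 <-]] := sup_adherent a0 sE.
rewrite -[sup E]/(dual_norm f) f1 => fx.
have [fx0|fx0] := leP 0 (f x).
  by exists x; split => //; rewrite -(ger0_norm fx0).
exists (- x); split; first by rewrite /unit_ball/= normrN.
by rewrite [f (- x)](linearN (sval f)) -(ltr0_norm fx0).
Qed.

Lemma rel_weakly_open_is_cc (W : set X) :
  rel_weakly_open W -> is_cc_weakly_open W.
Proof.
move=> oW; exists 1%N, (fun=> 1), (fun=> W); split => //.
- by move=> _; rewrite ler01 lexx.
- by rewrite big_ord1.
apply/seteqP; split => [w Ww|_ [w Ww <-]].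
  by exists (fun=> w) => //; rewrite big_ord1 scale1r.
by rewrite big_ord1 scale1r.
Qed.

Lemma inf_eq_ge (A : set R) (c : R) :
  (forall a, A a -> c <= a) -> (forall a, c < a -> A a) -> inf A = c.
Proof.
move=> lbA Ac; have A0 : A !=set0 by exists (c + 1); apply: Ac; rewrite ltrDl.
apply/eqP; rewrite eq_le; apply/andP; split; last exact: lb_le_inf.
apply/ler_addgt0Pr => e e0; apply: ge_inf; first by exists c.
by apply: Ac; rewrite ltrDl.
Qed.

(** Slices are nonempty relatively weakly open sets, and these are one-term convex combinations. The
    three sets of radii are thus nested: it suffices to bound the largest from below and to find
    every [rho > c] in the smallest. *)
Lemma daugavet_indices_eq (c : R) : 0 < c ->
    (forall x (C : set X) rho, unit_sphere x -> is_cc_weakly_open C ->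
       C !=set0 -> C `<=` ball x rho -> c <= rho) ->
    (forall rho, c < rho -> exists x S,
       [/\ @unit_sphere R X x, is_slice S & S `<=` ball x rho]) ->
  [/\ daugavet_Tcc X = c, daugavet_T X = c & daugavet_Ts X = c].
Proof.
move=> c0 lb ub.
have sS S : @is_slice R X S -> rel_weakly_open S /\ S !=set0.
  case=> f [a [f1 a0 ->]].
  by split; [exact: slice_rel_weakly_open|exact: slice_neq0].
split; apply: inf_eq_ge => rho.
- by move=> [_ [x [C [x1 cC C0 Cx]]]]; exact: (lb x C).
- move=> crho; split; first exact: lt_trans crho.
  have [x [S [x1 /sS[oS S0] Sx]]] := ub _ crho; exists x, S; split => //.
  exact: rel_weakly_open_is_cc.
- move=> [_ [x [W [x1 oW W0 Wx]]]]; apply: (lb x W) => //.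
  exact: rel_weakly_open_is_cc.
- move=> crho; split; first exact: lt_trans crho.
  by have [x [S [x1 /sS[oS S0] Sx]]] := ub _ crho; exists x, S.
- move=> [_ [x [S [x1 /sS[oS S0] Sx]]]]; apply: (lb x S) => //.
  exact: rel_weakly_open_is_cc.
- move=> crho; split; first exact: lt_trans crho.
  exact: ub.
Qed.

End WeakTopology.

(** * The vector space of bounded sequences *)

Definition bounded_seq {R : realType} : {pred nat -> R} :=
  [pred f : nat -> R | `[< exists M, forall n, `|f n| <= M >]].

Lemma bounded_seqP {R : realType} (f : nat -> R) :
  reflect (exists M, forall n, `|f n| <= M) (f \in bounded_seq).
Proof. exact: asboolP. Qed.

Lemma bounded_seq_submod {R : realType} :
  submod_closed (@bounded_seq R).
Proof.
split; first by apply/bounded_seqP; exists 0 => n; rewrite normr0.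
move=> a f g /bounded_seqP[M fM] /bounded_seqP[N gN].
apply/bounded_seqP; exists (`|a| * M + N) => n.
rewrite -[(a *: f + g) n]/(a * f n + g n) (le_trans (ler_normD _ _))//.
by rewrite lerD// normrM ler_wpM2l.
Qed.

HB.instance Definition _ (R : realType) :=
  GRing.isSubmodClosed.Build R (nat -> R) bounded_seq bounded_seq_submod.

(* Coordinate [0] is the component [a], coordinates [n.+1] form [y]. *)
Record tcone (R : realType) (r : {posnum R}) :=
  TCone { coords :> nat -> R; _ : coords \in bounded_seq }.

Section TCone.
Context {R : realType} {r : {posnum R}}.
Implicit Types (f g : tcone R r) (n : nat) (c : R).

HB.instance Definition _ := [isSub for @coords R r].
HB.instance Definition _ := [Choice of tcone R r by <:].
HB.instance Definition _ := [SubChoice_isSubLmodule of tcone R r by <:].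

Lemma tconeZE c f n : (c *: f) n = c * f n. Proof. by []. Qed.

Lemma tconeDE f g n : (f + g) n = f n + g n. Proof. by []. Qed.

Lemma tconeBE f g n : (f - g) n = f n - g n. Proof. by []. Qed.

Lemma tcone_bounded f : exists M, forall n, `|f n| <= M.
Proof. exact/bounded_seqP/(valP f). Qed.

(** * The truncated-cone norm *)

Definition coord_norm n f : R :=
  Num.max `|f 0| ((`|f 0| + `|f n.+1|) / (1 + r%:num)).

Definition tcone_norm f : R := sup (range (coord_norm^~ f)).

Lemma coord_norm_le n f c : coord_norm n f <= c <->
  `|f 0| <= c /\ `|f 0| + `|f n.+1| <= c * (1 + r%:num).
Proof.
rewrite /coord_norm ge_max ler_pdivrMr//.
by split => /andP.
Qed.

Lemma coord_norm_ubound f : has_ubound (range (coord_norm^~ f)).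
Proof.
have [M fM] := tcone_bounded f.
exists (2 * M) => _ [n _ <-]; have := fM 0%N; have := fM n.+1.
have f0 := normr_ge0 (f 0); move=> fn f0M.
have q0 : 0 < r%:num by [].
apply/coord_norm_le; split; first lra.
have M0 : 0 <= M by lra.
by have := mulr_ge0 M0 (ltW q0); lra.
Qed.

Lemma tcone_norm_le f c : tcone_norm f <= c <-> forall n, coord_norm n f <= c.
Proof.
split=> [fc n|fc].
  by apply: le_trans fc; apply: (ub_le_sup (coord_norm_ubound f)); exists n.
by apply: ge_sup; [exists (coord_norm 0 f), 0%N|move=> _ [n _ <-]].
Qed.

(** This division-free form turns norm estimates into linear arithmetic on the coordinates [0] and
    [n.+1]; taking [c] to be the norm itself extracts coordinate bounds. *)
Lemma tcone_norm_leP f c : tcone_norm f <= c <->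
  forall n, `|f 0| <= c /\ `|f 0| + `|f n.+1| <= c * (1 + r%:num).
Proof.
by rewrite tcone_norm_le; split => fc n; apply/coord_norm_le.
Qed.

Lemma tcone_normD f g : tcone_norm (f + g) <= tcone_norm f + tcone_norm g.
Proof.
have /tcone_norm_leP fN := lexx (tcone_norm f).
have /tcone_norm_leP gN := lexx (tcone_norm g).
apply/tcone_norm_leP => n; have [f0 fn] := fN n; have [g0 gn] := gN n.
have := ler_normD (f 0) (g 0); have := ler_normD (f n.+1) (g n.+1).
by rewrite !tconeDE mulrDl; split; lra.
Qed.

Lemma tcone_norm_scale_le c f : tcone_norm (c *: f) <= `|c| * tcone_norm f.
Proof.
have /tcone_norm_leP fN := lexx (tcone_norm f).
apply/tcone_norm_leP => n; have [f0 fn] := fN n.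
by rewrite !tconeZE !normrM -mulrDr -mulrA !ler_wpM2l.
Qed.

Lemma tcone_normZ c f : tcone_norm (c *: f) = `|c| * tcone_norm f.
Proof.
apply/eqP; rewrite eq_le tcone_norm_scale_le/=.
have [->|c0] := eqVneq c 0.
  rewrite normr0 mul0r scale0r.
  have /tcone_norm_leP/(_ 0%N)[+ _] := lexx (tcone_norm (0 : tcone R r)).
  exact: le_trans.
(* The reverse inequality is the same bound for the inverse scalar. *)
have := tcone_norm_scale_le c^-1 (c *: f).
rewrite scalerA mulVf// scale1r normfV => h.
by rewrite -ler_pdivlMl ?normr_gt0.
Qed.

Lemma tcone_norm0_eq0 f : tcone_norm f = 0 -> f = 0.
Proof.
move=> f0; have /tcone_norm_leP fN : tcone_norm f <= 0 by rewrite f0.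
apply/val_inj/funext => -[|n] /=; apply/normr0_eq0/eqP;
  rewrite eq_le normr_ge0 andbT.
  by have [] := fN 0%N.
by have [_] := fN n; rewrite mul0r; apply: le_trans; rewrite lerDr.
Qed.

(** The norm depends on [r], so [r] is a parameter of the type: each value carries its own normed
    structure. *)
HB.instance Definition _ := Lmodule_isNormed.Build R (tcone R r)
  tcone_normD tcone_normZ tcone_norm0_eq0.

Lemma tcone_normE f : `|f| = tcone_norm f. Proof. by []. Qed.

(** With [tcone_norm_le_coord], this makes the norm equivalent to the supremum norm of the
    coordinates. *)
Lemma coord_le_tcone_norm f n : `|f n| <= (1 + r%:num) * `|f|.
Proof.
have /tcone_norm_leP/(_ n.-1) := lexx (tcone_norm f); rewrite -tcone_normE.
have q0 : 0 < r%:num by []; move=> [f0 fn].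
case: n fn => [|n] /= fn; last by have := normr_ge0 (f 0); lra.
have N0 : 0 <= `|f| by exact: normr_ge0.
by have := mulr_ge0 N0 (ltW q0); lra.
Qed.

Lemma tcone_norm_le_coord f c : (forall n, `|f n| <= c) -> `|f| <= 2 * c.
Proof.
move=> fc; rewrite tcone_normE; apply/tcone_norm_leP => n.
have := fc 0%N; have := fc n.+1; have := normr_ge0 (f 0).
move=> f0 fn f0c; have q0 : 0 < r%:num by [].
have c0 : 0 <= c by lra.
by have := mulr_ge0 c0 (ltW q0); split; lra.
Qed.

(** * Completeness *)

(** A Cauchy filter is Cauchy uniformly in the coordinates, so the coordinatewise limit [l] is
    bounded and is approached uniformly. *)
Lemma tcone_complete (F : set_system (tcone R r)) :
  ProperFilter F -> cauchy F -> cvg F.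
Proof.
move=> FF /cauchyP Fc.
have near_coord (e : R) : 0 < e ->
    exists f, F [set g | forall n, `|f n - g n| < e].
  move=> e0; have [|f Ff] := Fc (e / (1 + r%:num)); first by rewrite divr_gt0.
  exists f; apply: filterS Ff => g /=.
  rewrite -ball_normE/= ltr_pdivlMr// mulrC => fg n.
  exact: le_lt_trans (coord_le_tcone_norm (f - g) n) fg.
have cvg_coord n : cvg ((fun f : tcone R r => f n : R^o) @ F).
  suff : cauchy_ex ((fun f : tcone R r => f n : R^o) @ F).
    by move=> /cauchy_exP h; exact: cauchy_cvg.
  move=> e /near_coord[f Ff].
  exists (f n); suff: F [set g | ball (f n : R^o) e (g n : R^o)] by [].
  by apply: filterS Ff => g /(_ n); rewrite -ball_normE.
pose l n : R := lim ((fun f : tcone R r => f n : R^o) @ F).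
have lF f (e : R) : F [set g | forall n, `|f n - g n| < e] ->
    forall n, `|f n - l n| <= e.
  move=> Ff n; rewrite distrC; apply/ler_addgt0Pr => d d0.
  have /cvgrPdist_lt/(_ d d0) ld := cvg_coord n.
  have [g [fg gl]] := filter_ex (filterI Ff ld).
  have := fg n; have := ler_normD (l n - g n) (g n - f n).
  by rewrite addrA subrK (distrC (g n)) => + h; move: gl => /=; lra.
have lb : l \in bounded_seq.
  have [f /lF fl] := near_coord _ ltr01.
  have [M fM] := tcone_bounded f.
  apply/bounded_seqP; exists (M + 1) => n.
  have := fl n; have := fM n; have := ler_normB (f n) (f n - l n).
  by rewrite opprB addrCA subrr addr0; lra.
apply/cvg_ex; exists (@TCone R r l lb : tcone R r).
apply/cvgrPdist_le => e e0.
(* Both [g] and [l] are within [e / 4] of [f] in each coordinate, hence within [e / 2] of each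
   other; [tcone_norm_le_coord] doubles this. *)
have [|f Ff] := near_coord (e / 4); first by rewrite divr_gt0.
apply: filterS (Ff) => g fg.
have -> : e = 2 * (e / 2) by field.
apply: tcone_norm_le_coord => n; have := lF _ _ Ff n; have := fg n.
rewrite tconeBE /=; have := ler_normB (f n - g n) (f n - l n).
by rewrite opprB addrC addrA subrK; lra.
Qed.

HB.instance Definition _ := Uniform_isComplete.Build (tcone R r) tcone_complete.

(** * Coordinate functionals and weakly null unit sequences *)

Definition coord n f : R := f n.

Lemma coord_is_linear n : linear (coord n : tcone R r -> R^o).
Proof. by []. Qed.

HB.instance Definition _ n :=
  GRing.isLinear.Build R (tcone R r) R^o *:%R (coord n) (coord_is_linear n).

Lemma coord_continuous n : continuous (coord n : tcone R r -> R^o).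
Proof.
apply: bounded_linear_continuous; apply/bounded_funP => a.
exists ((1 + r%:num) * a) => f fa.
by rewrite (le_trans (coord_le_tcone_norm f n))// ler_wpM2l.
Qed.

Definition coord_dual n : dual (tcone R r) :=
  exist _ (coord n : {scalar tcone R r}) (@coord_continuous n).

Lemma delta_bounded n : (fun k => (k == n)%:R : R) \in bounded_seq.
Proof.
by apply/bounded_seqP; exists 1 => k; case: (k == n); rewrite ?normr1 ?normr0.
Qed.

Definition delta n : tcone R r := @TCone R r _ (delta_bounded n).

Lemma deltaE n k : delta n k = (k == n)%:R. Proof. by []. Qed.

Lemma delta_neq0 n : delta n != 0.
Proof.
apply/eqP => /(congr1 (coord n)) /eqP.
by rewrite /coord deltaE eqxx oner_eq0.
Qed.

Lemma tcone_sumE (I : Type) (s : seq I) (P : pred I) (F : I -> tcone R r) n :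
  (\sum_(i <- s | P i) F i) n = \sum_(i <- s | P i) F i n.
Proof. exact: (linear_sum (coord n : {scalar tcone R r})). Qed.

(* Testing on the signed sums [\sum_(n < N) Num.sg (f (delta n)) *: delta n],
   which stay bounded, shows that [f (delta n)] is absolutely summable. *)
Lemma dual_delta_cvg0 (f : dual (tcone R r)) : f (delta n) @[n --> \oo] --> 0.
Proof.
have /linear_boundedP[B [_ fB]] : bounded_near f (nbhs (0 : tcone R r)).
  by apply/(@linear_bounded_continuous _ _ _ (sval f)); exact: (svalP f).
pose M := B + 1.
have fM x : `|f x| <= M * `|x| by apply: fB; rewrite ltrDl.
have M0 : 0 <= M.
  by rewrite -(pmulr_lge0 _ (x := `|delta 0|)) ?normr_gt0 ?delta_neq0//
    (le_trans _ (fM _)).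
apply: norm_cvg0; apply: cvg_series_cvg_0; apply: nondecreasing_is_cvgn.
  exact: nondecreasing_series.
(* The coordinates of the signed sums have modulus at most [1], so their norms are at most [2]. *)
exists (M * 2) => _ [N _ <-].
pose s := \sum_(n < N) Num.sg (f (delta n)) *: delta n.
have -> : series (fun n => `|f (delta n)|) N = f s.
  rewrite /series/= big_mkord [f s](linear_sum (sval f)).
  apply: eq_bigr => n _; rewrite [in RHS]linearZ/=.
  exact: normrEsg.
apply: le_trans (ler_norm _) (le_trans (fM _) _).
apply: ler_wpM2l => //; rewrite -[leRHS]mulr1; apply: tcone_norm_le_coord => k.
rewrite tcone_sumE; under eq_bigr do rewrite tconeZE deltaE.
have [kN|Nk] := ltnP k N.
  rewrite (bigD1 (Ordinal kN))//= big1 ?addr0.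
    by rewrite eqxx mulr1 normr_sg; case: (_ != 0).
  by move=> i; rewrite -val_eqE/= eq_sym => /negbTE ->; rewrite mulr0.
rewrite big1 ?normr0// => i _; rewrite gtn_eqF ?mulr0//.
exact: leq_trans (ltn_ord i) Nk.
Qed.

(** * The two estimates: convex combinations from below, slices from above *)

Lemma tcone_cc_far (x : tcone R r) (C : set (tcone R r)) (rho : R) :
    is_cc_weakly_open C -> C !=set0 -> C `<=` ball x rho ->
  r%:num / (1 + r%:num) <= rho.
Proof.
move=> [m [l [W [l01 l1 oW ->]]]] [_ [w Ww _]] Cx.
(* The value [s n] does not depend on the index [i] of the summand, so it survives in the convex
   combination. *)
pose s n : R := if x n.+1 <= 0 then r%:num else - r%:num.
have sr n : `|s n| = r%:num by rewrite /s; case: ifP; rewrite ?normrN gtr0_norm.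
have q0 : 0 < r%:num by [].
have sx n : r%:num <= `|x n.+1 - s n|.
  rewrite /s; case: ifPn => [x0|]; first by rewrite ler0_norm ?opprB; lra.
  by rewrite -ltNge => x0; rewrite opprK gtr0_norm; lra.
pose v i n : tcone R r := w i + (s n - w i n.+1) *: delta n.+1.
have vE i n k : v i n k = if k == n.+1 then s n else w i k.
  rewrite tconeDE tconeZE deltaE; case: eqVneq => [->|_].
    by rewrite mulr1 addrC subrK.
  by rewrite mulr0 addr0.
have vW i : \forall n \near \oo, W i (v i n).
  have [U oU WU] := oW i; have := Ww i; rewrite WU => -[w1 Uw].
  have Uv : \forall n \near \oo, U (v i n).
    apply: weakly_open_near oU Uw _ => f.
    (* [K] bounds [s n - w i n.+1] uniformly in [n], so [f (v i n) - f (w i)] tends to [0] with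
       [f (delta n.+1)]. *)
    pose K := r%:num + (1 + r%:num) * `|w i|.
    have K0 : 0 < K by rewrite ltr_pwDl// mulr_ge0.
    apply/cvgrPdist_le => e e0.
    have /cvgr0Pnorm_le : f (delta n.+1) @[n --> \oo] --> 0.
      by rewrite (cvg_shiftS (fun n => f (delta n))); exact: dual_delta_cvg0.
    move=> /(_ (e / K)); rewrite divr_gt0// => /(_ isT).
    apply: filterS => n; rewrite ler_pdivlMr// mulrC => fe.
    rewrite /= [f (v i n)]linearD linearZ/= -/(f _) -/(f _).
    rewrite opprD addrA subrr sub0r normrN normrM (le_trans _ fe)// ler_wpM2r//.
    rewrite (le_trans (ler_normB _ _))// sr lerD2l.
    exact: coord_le_tcone_norm.
  apply: filterS Uv => n Uv; split => //.
  (* The perturbed point stays in the ball: the changed coordinate has modulus [r], and the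
     coordinate [0] has modulus at most [1]. *)
  rewrite /unit_ball/= tcone_normE; apply/tcone_norm_leP => k.
  have /tcone_norm_leP/(_ k) : tcone_norm (w i) <= 1 by [].
  by rewrite !vE/=; case: ifP => // _; rewrite sr; lra.
(* There are finitely many summands, so a single [n] serves them all. *)
have /filter_ex[n vn] := filter_forall eventually_filter vW.
pose z := \sum_(i < m) l i *: v i n.
have zn : z n.+1 = s n.
  rewrite tcone_sumE -[RHS]mul1r -l1 mulr_suml; apply: eq_bigr => i _.
  by rewrite tconeZE vE eqxx.
have : ball x rho z by apply: Cx; exists (v ^~ n).
rewrite -ball_normE/= => /ltW; rewrite tcone_normE => /tcone_norm_leP/(_ n)[_].
rewrite (tconeBE x z n.+1) zn => h; rewrite ler_pdivrMr//; apply: le_trans h.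
by rewrite (le_trans (sx n))// lerDr.
Qed.

Lemma tcone_slice_near (rho : R) : r%:num / (1 + r%:num) < rho ->
  exists (x : tcone R r) S, [/\ unit_sphere x, is_slice S & S `<=` ball x rho].
Proof.
rewrite ltr_pdivrMr// => rrho; have r0 : 0 < r%:num by [].
have d1 : unit_sphere (delta 0).
  rewrite /unit_sphere/=; apply/eqP; rewrite eq_le; apply/andP; split.
    rewrite tcone_normE; apply/tcone_norm_leP => n.
    by rewrite !deltaE normr1 normr0; split; lra.
  have /tcone_norm_leP/(_ 0%N)[+ _] := lexx (tcone_norm (delta 0)).
  by rewrite deltaE normr1.
have rho0 : 0 < rho.
  by rewrite -(pmulr_lgt0 _ (x := 1 + r%:num))// (lt_trans _ rrho).
(* On the slice, [1 - f 0 < e] and [|f n.+1| < r + e], so the two moduli for [delta 0 - f] sum to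
   less than [r + 2 * e]. The choice of [e] makes this at most [c * (1 + r)] for the [c] below. *)
pose e := Num.min (rho / 2) ((rho * (1 + r%:num) - r%:num) / 4).
have e0 : 0 < e by rewrite lt_min; apply/andP; split; lra.
have [e1 e2] : e <= rho / 2 /\ e <= (rho * (1 + r%:num) - r%:num) / 4.
  by split; rewrite ge_min lexx ?orbT.
exists (delta 0), (slice (coord_dual 0) e); split => //.
  exists (coord_dual 0), e; split => //.
  have ub1 : ubound [set `|coord_dual 0 f| | f in @unit_ball R (tcone R r)] 1.
    by move=> _ [f /tcone_norm_leP/(_ 0%N)[f01 _] <-].
  rewrite /dual_sphere/= /dual_norm; apply/eqP; rewrite eq_le.
  apply/andP; split.
    apply: ge_sup => //; exists `|coord_dual 0 (delta 0)|, (delta 0) => //.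
    by rewrite /unit_ball/= d1.
  apply: ub_le_sup; first by exists 1.
  by exists (delta 0); [rewrite /unit_ball/= d1|rewrite [LHS]normr1].
move=> f [/tcone_norm_leP f1 fe]; rewrite -ball_normE/=.
have fe0 : 1 - e < f 0 := fe.
(* A bound strictly below [rho] is needed, because strict coordinate bounds only give a large
   inequality for the supremum. *)
pose c := (rho + r%:num / (1 + r%:num)) / 2.
have cE : c * (1 + r%:num) = (rho * (1 + r%:num) + r%:num) / 2.
  by rewrite /c; field; rewrite gt_eqF.
have q0 : 0 < r%:num / (1 + r%:num) by rewrite divr_gt0.
have q1 : r%:num / (1 + r%:num) < rho by rewrite ltr_pdivrMr.
apply: (@le_lt_trans _ _ c); last by rewrite /c; lra.
rewrite tcone_normE; apply/tcone_norm_leP => n; have [f01 fn] := f1 n.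
rewrite !tconeBE !deltaE/= sub0r normrN cE.
have f0 := ler_norm (f 0).
rewrite ger0_norm; last lra.
by rewrite /c; split; lra.
Qed.

End TCone.

Theorem proposition2p8 (R : realType) (r : R) (hr : 0 < r) :
  exists X : completeNormedModType R,
    [/\ exists x : X, x != 0,
        daugavet_Tcc X = r / (1 + r),
        daugavet_T X = r / (1 + r) &
        daugavet_Ts X = r / (1 + r)].
Proof.
have [|||Tcc T Ts] :=
  @daugavet_indices_eq R (tcone R (PosNum hr)) (r / (1 + r)).
- by rewrite divr_gt0// addr_gt0.
- by move=> x C rho _; exact: (@tcone_cc_far R (PosNum hr)).
- exact: (@tcone_slice_near R (PosNum hr)).
exists (tcone R (PosNum hr)); split => //.
exists (delta 0); exact: delta_neq0.
Qed.
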